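(* Let $G$ be a finite group with generating set $\mathcal C\subseteq G\setminus\{e\}$ closed under inverses and under self-conjugation (i.e. $b^{-1}ab\in\mathcal C$ for all $a,b\in\mathcal C$), and consider the Cayley graph with arrows $x\to xa$, $x\in G$, $a\in\mathcal C$. If $x\to y\to z$ is a 2-step in the Cayley graph, then $x\to xy^{-1}z\to z$ is also a 2-step. Define $\sigma$ by $$\sigma(\omega_{x\to y}\bar\otimes\omega_{y\to z})=\omega_{x\to xy^{-1}z}\bar\otimes\omega_{xy^{-1}z\to z}.$$ Then $(\sigma,0)$ provides a metric compatible bimodule connection for the Euclidean metric, namely $$\nabla e_a=\sum_{b\in\mathcal C}e_b\bar\otimes(e_a-e_{b^{-1}ab}),\qquad \sigma(e_a\bar\otimes e_b)=e_b\bar\otimes e_{b^{-1}ab}\qquad(a,b\in\mathcal C),$$ and $\sigma$ obeys the braid relations $\sigma_{12}\sigma_{23}\sigma_{12}=\sigma_{23}\sigma_{12}\sigma_{23}$. Moreover, the resulting Laplace-Beltrami operator $\Delta=(\ ,\ )\nabla\mathrm{d}$ on $k(G)$ is $\Delta=2L$.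
   Context: $k$ is a field of characteristic not $2$, $A=k(G)$ the algebra of $k$-valued functions on $G$. $\Omega^1$ is the $A$-$A$-bimodule with $k$-basis $\{\omega_{x\to y}\}$ indexed by the arrows of the Cayley graph, $f\omega_{x\to y}=f(x)\omega_{x\to y}$, $\omega_{x\to y}f=f(y)\omega_{x\to y}$, $\mathrm{d}f=\sum_{x\to y}(f(y)-f(x))\omega_{x\to y}$; $\bar\otimes=\otimes_A$; $\theta=\sum_{x\to y}\omega_{x\to y}$; $\delta_x$ is the Kronecker delta function. The left-invariant 1-forms $e_a=\sum_{x\in G}\omega_{x\to xa}$, $a\in\mathcal C$, form a basis of $\Omega^1$ over $k(G)$, and $\theta=\sum_{a\in\mathcal C}e_a$. Euclidean metric: $\mathfrak g=\sum_{x\to y}\omega_{x\to y}\bar\otimes\omega_{y\to x}=\sum_{a}e_a\bar\otimes e_{a^{-1}}$, with inverse the bimodule map $(\omega_{x\to y},\omega_{y'\to x'})=\delta_{x,x'}\delta_{y,y'}\delta_x$. The bimodule connection defined by $(\sigma,0)$, for a bimodule map $\sigma:\Omega^1\bar\otimes\Omega^1\to\Omega^1\bar\otimes\Omega^1$, is $\nabla\omega=\theta\bar\otimes\omega-\sigma(\omega\bar\otimes\theta)$; it satisfies $\nabla(f\omega)=\mathrm{d}f\bar\otimes\omega+f\nabla\omega$ and $\nabla(\omega f)=(\nabla\omega)f+\sigma(\omega\bar\otimes\mathrm{d}f)$. It is metric compatible if $\nabla\mathfrak g:=(\nabla\otimes\mathrm{id})\mathfrak g+(\sigma\otimes\mathrm{id})(\mathrm{id}\otimes\nabla)\mathfrak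 g=0$. $L$ is the graph Laplacian $(Lf)(x)=\sum_{y:\,x\to y}(f(x)-f(y))$. $\sigma_{12},\sigma_{23}$ denote $\sigma$ acting in the indicated factors of $\Omega^1\bar\otimes\Omega^1\bar\otimes\Omega^1$. *)

(* Defs.v *)
From HB Require Import structures.
From mathcomp Require Import all_boot all_order all_algebra all_fingroup.

Set Implicit Arguments.
Unset Strict Implicit.
Unset Printing Implicit Defensive.

Import GRing.Theory.
Local Open Scope ring_scope.

(* k^o is k as a vector space over itself, so that fct k T is one. *)
Notation fct k T := {ffun T -> k^o}.

(* A quiver Q on a finite vertex set V determines the bimodule over the algebra
   k(V) = fct k V with k-basis the arrows of Q, on which f acts by the scalar
   f (src p) from the left and f (tgt p) from the right. *)
Record quiver (V : finType) := Quiver {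
  arrow :> finType;
  src : arrow -> V;
  tgt : arrow -> V
}.

Notation bimod k Q := (fct k (arrow Q)).

Definition basis (k : fieldType) (T : finType) (t : T) : fct k T :=
  [ffun u => (u == t)%:R].
Arguments basis k {T} t.

Section Bimodules.
Variables (k : fieldType) (V : finType).
Implicit Types Q R S : quiver V.

Definition lact Q (f : fct k V) (w : bimod k Q) : bimod k Q :=
  [ffun p => f (src p) * w p].
Definition ract Q (w : bimod k Q) (f : fct k V) : bimod k Q :=
  [ffun p => w p * f (tgt p)].

(* The tensor product over k(V) has as basis the composable pairs of arrows:
   if tgt p != src q then the tensor product of the basis elements p and q is 0.
   That this is the tensor product over k(V) is lemmas [tens_balanced],
   [lift_tens] and [lift_unique]. *)
Definition tensor_quiver Q R : quiver V :=
  @Quiver V {pq : Q * R | tgt pq.1 == src pq.2}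
    (fun pq => src (val pq).1) (fun pq => tgt (val pq).2).

Definition tens Q R (w : bimod k Q) (e : bimod k R) :
    bimod k (tensor_quiver Q R) :=
  [ffun pq => w (val pq).1 * e (val pq).2].

Definition balanced Q R (U : zmodType) (B : bimod k Q -> bimod k R -> U) :=
  [/\ forall e, {morph B^~ e : w w' / w + w'},
      forall w, {morph B w : e e' / e + e'} &
      forall w f e, B (ract w f) e = B w (lact f e)].

(* The map on the tensor product induced by a balanced biadditive map B. *)
Definition lift Q R (U : zmodType) (B : bimod k Q -> bimod k R -> U)
    (t : bimod k (tensor_quiver Q R)) : U :=
  \sum_(pq : tensor_quiver Q R)
     B (t pq *: basis k (val pq).1) (basis k (val pq).2).

Definition bimodule_map Q R (s : bimod k Q -> bimod k R) :=
  [/\ {morph s : w w' / w + w'},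
      forall f w, s (lact f w) = lact f (s w) &
      forall w f, s (ract w f) = ract (s w) f].

Definition assoc Q R S :
    bimod k (tensor_quiver Q (tensor_quiver R S)) ->
    bimod k (tensor_quiver (tensor_quiver Q R) S) :=
  lift (fun w => lift (fun e z => tens (tens w e) z)).
Definition unassoc Q R S :
    bimod k (tensor_quiver (tensor_quiver Q R) S) ->
    bimod k (tensor_quiver Q (tensor_quiver R S)) :=
  lift (fun t z => lift (fun w e => tens w (tens e z)) t).

Section Endo.
Variables (Q : quiver V).
Let Q2 := tensor_quiver Q Q.
Let Q3 := tensor_quiver Q2 Q.
Variable sigma : bimod k Q2 -> bimod k Q2.

Definition sigma12 : bimod k Q3 -> bimod k Q3 :=
  lift (fun t z => tens (sigma t) z).
Definition sigma23 (t : bimod k Q3) : bimod k Q3 :=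
  assoc (lift (fun w u => tens w (sigma u)) (unassoc t)).
End Endo.

End Bimodules.

(* The calculus on a digraph, whose arrows are the pairs (x, y) with g x y. *)
Definition digraph (V : finType) (g : rel V) : quiver V :=
  @Quiver V {xy : V * V | g xy.1 xy.2}
    (fun p => (val p).1) (fun p => (val p).2).

Section Calculus.
Variables (k : fieldType) (V : finType) (g : rel V).

Definition Omega1 := digraph g.
Definition Omega2 := tensor_quiver Omega1 Omega1.
Definition Omega3 := tensor_quiver Omega2 Omega1.

(* omega_{x -> y}; it is 0 when there is no arrow from x to y. *)
Definition omega (x y : V) : bimod k Omega1 := [ffun p => (val p == (x, y))%:R].

Definition theta : bimod k Omega1 := \sum_x \sum_(y | g x y) omega x y.

Definition diff (f : fct k V) : bimod k Omega1 :=
  \sum_x \sum_(y | g x y) (f y - f x) *: omega x y.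

Definition laplacian (f : fct k V) : fct k V :=
  [ffun x => \sum_(y | g x y) (f x - f y)].

Definition eucl_metric : bimod k Omega2 :=
  \sum_x \sum_(y | g x y) tens (omega x y) (omega y x).

Definition eucl_pairing (w e : bimod k Omega1) : fct k V :=
  \sum_(p : Omega1) \sum_(q : Omega1)
    (w p * e q) *:
      (((src p == tgt q)%:R * (tgt p == src q)%:R) *: basis k (src p)).

Definition eucl_inv : bimod k Omega2 -> fct k V := lift eucl_pairing.

Section Connection.
Variables (sigma : bimod k Omega2 -> bimod k Omega2)
          (nabla : bimod k Omega1 -> bimod k Omega2).

Definition bimodule_connection :=
  [/\ {morph nabla : w w' / w + w'},
      bimodule_map sigma,
      forall f w, nabla (lact f w) = tens (diff f) w + lact f (nabla w) &
      forall w f,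
        nabla (ract w f) = ract (nabla w) f + sigma (tens w (diff f))].

(* nabla (x) id + (sigma (x) id)(id (x) nabla); only the sum of the two terms is
   defined on the tensor product over k(V), see [tensor_connection_tens]. *)
Definition tensor_connection : bimod k Omega2 -> bimod k Omega3 :=
  lift (fun w e => tens (nabla w) e + sigma12 sigma (assoc (tens w (nabla e)))).

Definition metric_compatible := tensor_connection eucl_metric = 0.

Definition laplace_beltrami (f : fct k V) : fct k V :=
  eucl_inv (nabla (diff f)).
End Connection.

Definition connection_of (sigma : bimod k Omega2 -> bimod k Omega2)
    (w : bimod k Omega1) : bimod k Omega2 :=
  tens theta w - sigma (tens w theta).

End Calculus.

Arguments omega k {V} g x y.
Arguments theta k {V} g.
Arguments eucl_metric k {V} g.

Section Cayley.
Variables (k : fieldType) (gT : finGroupType) (C : {set gT}).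

Definition cayley : rel gT := fun x y => (x^-1 * y)%g \in C.

Definition left_form (a : gT) : bimod k (Omega1 cayley) :=
  \sum_x omega k cayley x (x * a)%g.

Definition cayley_sigma (t : bimod k (Omega2 cayley)) : bimod k (Omega2 cayley) :=
  \sum_(pq : Omega2 cayley)
    let x := src (val pq).1 in
    let y := tgt (val pq).1 in
    let z := tgt (val pq).2 in
    t pq *: tens (omega k cayley x (x * y^-1 * z)%g)
                 (omega k cayley (x * y^-1 * z)%g z).

End Cayley.

Lemma fctZ (k : fieldType) (T : finType) (c : k) (w : fct k T) t :
  (c *: w) t = c * w t.
Proof. by rewrite ffunE. Qed.

Lemma basis_sum (k : fieldType) (T : finType) (w : fct k T) :
  w = \sum_t w t *: basis k t.
Proof.
apply/ffunP=> u; rewrite sum_ffunE (bigD1 u) //= fctZ ffunE eqxx mulr1.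
by rewrite big1 ?addr0 // => t /negPf nut; rewrite fctZ ffunE eq_sym nut mulr0.
Qed.

Lemma morph_add0 (U W : zmodType) (h : U -> W) :
  {morph h : x y / x + y} -> h 0 = 0.
Proof. by move=> hD; apply: (addIr (h 0)); rewrite -hD !add0r. Qed.

Lemma morph_add_sum (U W : zmodType) (h : U -> W) (I : finType) (F : I -> U) :
  {morph h : x y / x + y} -> h (\sum_i F i) = \sum_i h (F i).
Proof. by move=> hD; apply: (big_morph h hD (morph_add0 hD)). Qed.

Section TensorTheory.
Variables (k : fieldType) (V : finType) (Q R : quiver V).

Lemma tensE (w : bimod k Q) (e : bimod k R)  pq :
  tens w e pq = w (val pq).1 * e (val pq).2 :> k.
Proof. by rewrite ffunE. Qed.

Lemma tens_balanced : balanced (@tens k V Q R).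
Proof.
split=> [e w w'|w e e'|w f e]; apply/ffunP=> pq; rewrite !ffunE.
- by rewrite mulrDl.
- by rewrite mulrDr.
- by rewrite -(eqP (valP pq)) mulrA.
Qed.

Lemma lift_tens (U : zmodType) (B : bimod k Q -> bimod k R -> U) w e :
  balanced B -> lift B (tens w e) = B w e.
Proof.
case=> BDl BDr Bm.
have BZ c w' e' : B (c *: w') e' = B w' (c *: e').
  have := Bm w' [ffun=> c] e'; congr (B _ _ = B _ _).
    by apply/ffunP=> p; rewrite fctZ !ffunE mulrC.
  by apply/ffunP=> p; rewrite fctZ !ffunE.
have B0 p q : tgt p != src q -> B (w p *: basis k p) (e q *: basis k q) = 0.
  move=> npq.
  have -> : w p *: basis k p = ract (w p *: basis k p) (basis k (tgt p)).
    apply/ffunP=> p'; rewrite [RHS]ffunE !fctZ !ffunE.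
    by have [->|_] := eqVneq p' p; rewrite ?eqxx ?mulr1 // !mulr0 mul0r.
  rewrite Bm (_ : lact _ _ = 0) ?(morph_add0 (BDr _)) //.
  apply/ffunP=> q'; rewrite ffunE fctZ !ffunE.
  by have [->|_] := eqVneq q' q; rewrite ?mulr0 // eq_sym (negPf npq) mul0r.
rewrite [in RHS](basis_sum w) [in RHS](basis_sum e).
rewrite (morph_add_sum _ (BDl _)).
under [RHS]eq_bigr do rewrite (morph_add_sum _ (BDr _)).
rewrite pair_big /= (bigID (fun pq => tgt pq.1 == src pq.2)) /=.
rewrite [X in _ = _ + X]big1 ?addr0; last by move=> [p q] /=; apply: B0.
rewrite /lift [RHS](reindex_omap (val : tensor_quiver Q R -> Q * R) insub) /=;
  last by move=> pq Ppq; rewrite insubT.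
apply: eq_big => [pq|pq _]; first by rewrite valK eqxx andbT (valP pq).
by rewrite ffunE mulrC -scalerA BZ.
Qed.

Lemma lift_unique (U : zmodType) (B : bimod k Q -> bimod k R -> U) h :
  {morph h : t t' / t + t'} -> (forall w e, h (tens w e) = B w e) ->
  forall t, h t = lift B t.
Proof.
move=> hD hB t; rewrite {1}(basis_sum t) (morph_add_sum _ hD).
apply: eq_bigr => pq _.
rewrite -hB; congr h; apply/ffunP=> pq'; rewrite [RHS]ffunE !fctZ !ffunE -mulrA.
rewrite -natrM mulnb -val_eqE /=.
by case: (val pq') (val pq) => [? ?] [].
Qed.

Lemma liftD (U : zmodType) (B : bimod k Q -> bimod k R -> U) :
  balanced B -> {morph lift B : t t' / t + t'}.
Proof.
case=> BDl _ _ t t'; rewrite /lift -big_split /=; apply: eq_bigr => pq _.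
by rewrite ffunE scalerDl BDl.
Qed.
End TensorTheory.

Section Associativity.
Variables (k : fieldType) (V : finType) (Q R S : quiver V).
Implicit Types (w : bimod k Q) (e : bimod k R) (z : bimod k S).

Lemma balanced_tens_tens w :
  balanced (fun e z => tens (tens w e) z).
Proof.
have [D1 D2 Dm] := @tens_balanced k V Q R.
have [D1' D2' Dm'] := @tens_balanced k V (tensor_quiver Q R) S.
split=> [z e e'|e z z'|e f z]; rewrite ?D2 ?D1' ?D2' -?Dm' //.
by congr tens; apply/ffunP=> pq; rewrite !ffunE mulrA.
Qed.

Lemma balanced_assoc :
  balanced (fun w => lift (fun e z => tens (tens w e) z)).
Proof.
have [D1 _ Dm] := @tens_balanced k V Q R.
have [D1' _ _] := @tens_balanced k V (tensor_quiver Q R) S.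
split=> [t w w'|w|w f t].
- by rewrite /lift -big_split; apply: eq_bigr => pq _; rewrite D1 D1'.
- exact/liftD/balanced_tens_tens.
apply: eq_bigr => pq _; congr tens; rewrite Dm; congr tens.
apply/ffunP=> p; rewrite ffunE !fctZ !ffunE /=.
by case: eqVneq => [->|_]; rewrite ?mulr0 // !mulr1.
Qed.

Lemma assoc_tens w e z : assoc (tens w (tens e z)) = tens (tens w e) z.
Proof.
rewrite /assoc lift_tens; last exact: balanced_assoc.
by rewrite lift_tens //; apply: balanced_tens_tens.
Qed.

Lemma balanced_tens_tens_r z :
  balanced (fun w e => tens w (tens e z)).
Proof.
have [D1 D2 Dm] := @tens_balanced k V R S.
have [D1' D2' Dm'] := @tens_balanced k V Q (tensor_quiver R S).
split=> [e w w'|w e e'|w f e]; rewrite ?D1 ?D1' ?D2' ?Dm' //.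
by congr tens; apply/ffunP=> pq; rewrite !ffunE mulrA.
Qed.

Lemma balanced_unassoc :
  balanced (fun t z => lift (fun w e => tens w (tens e z)) t).
Proof.
have [_ D2 Dm] := @tens_balanced k V R S.
have [_ D2' _] := @tens_balanced k V Q (tensor_quiver R S).
split=> [z|t z z'|t f z].
- exact/liftD/balanced_tens_tens_r.
- by rewrite /lift -big_split; apply: eq_bigr => pq _; rewrite D2 D2'.
apply: eq_bigr => pq _; set q := (val pq).2.
rewrite -Dm (_ : ract (basis k q) f = f (tgt q) *: basis k q); last first.
  apply/ffunP=> q'; rewrite fctZ !ffunE mulrC.
  by case: eqVneq => [->|]; rewrite ?mulr0.
apply/ffunP=> u; rewrite !(tensE, fctZ) ffunE -!mulrA.
by congr (_ * _); rewrite /= mulrCA.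
Qed.

Lemma unassoc_tens w e z : unassoc (tens (tens w e) z) = tens w (tens e z).
Proof.
rewrite /unassoc lift_tens; last exact: balanced_unassoc.
by rewrite lift_tens //; apply: balanced_tens_tens_r.
Qed.
End Associativity.

Lemma sigma12_tens (k : fieldType) (V : finType) (Q : quiver V)
    (sigma : bimod k (tensor_quiver Q Q) -> bimod k (tensor_quiver Q Q)) t z :
  bimodule_map sigma -> sigma12 sigma (tens t z) = tens (sigma t) z.
Proof.
case=> sD _ sR; rewrite /sigma12 lift_tens //.
have [D1 D2 Dm] := @tens_balanced k V (tensor_quiver Q Q) Q.
by split=> [e w w'|w e e'|w f e]; rewrite ?sD ?sR ?D1 ?D2 ?Dm.
Qed.

Lemma sigma23_tens (k : fieldType) (V : finType) (Q : quiver V)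
    (sigma : bimod k (tensor_quiver Q Q) -> bimod k (tensor_quiver Q Q)) w e z :
  bimodule_map sigma ->
  sigma23 sigma (tens (tens w e) z) = assoc (tens w (sigma (tens e z))).
Proof.
case=> sD sL _; rewrite /sigma23 unassoc_tens lift_tens //.
have [D1 D2 Dm] := @tens_balanced k V Q (tensor_quiver Q Q).
by split=> [u v v'|v u u'|v f u]; rewrite ?sD ?sL ?D1 ?D2 ?Dm.
Qed.

Lemma tensor_connection_tens (k : fieldType) (V : finType) (g : rel V)
    (sigma : bimod k (Omega2 g) -> bimod k (Omega2 g))
    (nabla : bimod k (Omega1 g) -> bimod k (Omega2 g)) w e :
  bimodule_connection sigma nabla ->
  tensor_connection sigma nabla (tens w e) =
    tens (nabla w) e + sigma12 sigma (assoc (tens w (nabla e))).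
Proof.
case=> nD smap nL nR; rewrite /tensor_connection lift_tens //.
have [D1 D2 Dm] := @tens_balanced k V (Omega1 g) (Omega1 g).
have [D1' D2' Dm'] := @tens_balanced k V (Omega1 g) (Omega2 g).
have [E1 E2 Em] := @tens_balanced k V (Omega2 g) (Omega1 g).
have aD : {morph @assoc k V (Omega1 g) (Omega1 g) (Omega1 g) : x y / x + y}.
  exact/liftD/balanced_assoc.
have s12D : {morph sigma12 sigma : x y / x + y}.
  apply: liftD; case: smap => sD _ sR.
  by split=> [u v v'|v u u'|v f u]; rewrite ?sD ?sR ?E1 ?E2 ?Em.
split=> [u v v'|v u u'|v f u].
- by rewrite nD E1 D1' aD s12D addrACA.
- by rewrite nD E2 D2' aD s12D addrACA.
rewrite nR nL E1 Em D2' aD s12D assoc_tens sigma12_tens //.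
by rewrite Dm' addrA.
Qed.

Section EuclideanMetric.
Variables (k : fieldType) (V : finType) (g : rel V).

Lemma eucl_pairing_omega x y x' y' : g x y -> g y' x' ->
  eucl_pairing (omega k g x y) (omega k g y' x') =
    ((x == x')%:R * (y == y')%:R) *: basis k x.
Proof.
move=> gxy gyx.
have omE a b (gab : g a b) : omega k g a b = basis k (Sub (a, b) gab : Omega1 g).
  by apply/ffunP=> p; rewrite !ffunE.
pose p0 : Omega1 g := Sub (x, y) gxy; pose q0 : Omega1 g := Sub (y', x') gyx.
rewrite (omE _ _ gxy) (omE _ _ gyx) -/p0 -/q0 /eucl_pairing.
rewrite (bigD1 p0) //= (bigD1 q0) //= !ffunE !eqxx mulr1 scale1r.
rewrite big1 ?addr0 ?big1 ?addr0 //.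
- by move=> p /negPf pn; rewrite big1 // => q _; rewrite !ffunE pn mul0r scale0r.
- by move=> q /negPf qn; rewrite !ffunE qn mulr0 scale0r.
Qed.

Lemma eucl_inv_tens w e : eucl_inv (g := g) (tens w e) = eucl_pairing w e :> fct k V.
Proof.
rewrite /eucl_inv lift_tens //; split=> [u v v'|v u u'|v f u];
  rewrite /eucl_pairing -?big_split; apply: eq_bigr => p _;
  rewrite -?big_split; apply: eq_bigr => q _.
- by rewrite ffunE mulrDl scalerDl.
- by rewrite ffunE mulrDr scalerDl.
rewrite !ffunE mulrA.
by have [->|_] := eqVneq (tgt p) (src q); rewrite ?mulr0 ?scale0r ?scaler0.
Qed.
End EuclideanMetric.

Lemma cayley_sigma_omega (k : fieldType) (gT : finGroupType) (C : {set gT})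
    x y z : cayley C x y -> cayley C y z ->
  cayley_sigma (tens (omega k (cayley C) x y) (omega k (cayley C) y z)) =
    tens (omega k (cayley C) x (x * y^-1 * z)%g)
         (omega k (cayley C) (x * y^-1 * z)%g z).
Proof.
move=> xy yz; pose p : Omega1 (cayley C) := Sub (x, y) xy.
pose q : Omega1 (cayley C) := Sub (y, z) yz.
have pq : tgt p == src q by [].
rewrite /cayley_sigma (bigD1 (Sub (p, q) pq : Omega2 (cayley C))) //=.
rewrite !ffunE /= !eqxx mulr1 scale1r big1 ?addr0 // => -[[p' q'] /= H] nq.
rewrite !ffunE /= -natrM mulnb (_ : _ && _ = false) ?scale0r //.
apply/negbTE; apply: contra nq => /andP[/eqP e1 /eqP e2].
by rewrite -val_eqE /= xpair_eqE -!val_eqE /= e1 e2 !eqxx.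
Qed.

(* Main.v *)
From HB Require Import structures.
From mathcomp Require Import all_boot all_order all_algebra all_fingroup.
Require Import Defs.
Import GRing.Theory.
Local Open Scope ring_scope.

Set Implicit Arguments.
Unset Strict Implicit.

(** Everything is read off the left-invariant forms e_a. They generate Omega^1
    as a left k(G)-module, so their tensor products generate the tensor powers
    ([left_generating_left_form], [left_generating_tens]), and additive maps
    are compared on the left multiples of these products ([eq_on_generators]).
    Along the 2-step x -> xa -> xab the middle vertex x y^-1 z is xb, so sigma
    is the conjugation braiding e_a (x) e_b |-> e_b (x) e_{b^-1 a b}
    ([sigma_left_form]), and the braid relation becomes the identity
    (a^c)^(b^c) = (a^b)^c in G.

    Two claims hold for any bimodule map sigma on any digraph. As
    df = theta f - f theta, nabla w = theta (x) w - sigma(w (x) theta) is a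
    bimodule connection ([bimodule_connection_of]). In
    nabla (w (x) e) the two middle terms, both sigma(w (x) theta) (x) e,
    cancel, leaving
    theta (x) w (x) e - sigma_12 sigma_23 (w (x) e (x) theta)
    ([tensor_connection_ofE]). On the Cayley graph sigma_12 sigma_23 moves
    e_b from the right of e_a (x) e_{a^-1} to its left while conjugating
    a by b. Since conjugation permutes G, summing over a and b gives
    sigma_12 sigma_23 (g (x) theta) = theta (x) g, which is metric
    compatibility.

    For the Laplacian, sigma changes only the middle vertex of a 2-step, whereas
    the inverse metric sees only its endpoints; hence the inverse metric absorbs
    sigma ([eucl_inv_sigma]) and Delta f = (theta, df) - (df, theta). Each
    of the two terms contributes one L f.

    As e_a = 0 for a outside C, sums over C are taken over all of G, where
    conjugation by any element is a bijection. *)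

(** * Tensor products and left generators *)


(** Because the basis of arrows is homogeneous for the left action, generation as
    a left k(V)-module can be tested arrow by arrow, with the idempotent at the
    source as coefficient. *)
Definition left_generating (k : fieldType) (V : finType) (Q : quiver V)
    (I : finType) (F : I -> bimod k Q) :=
  forall p : Q, exists i, basis k p = lact (basis k (src p)) (F i).

Section Bimodules.
Variables (k : fieldType) (V : finType) (Q R : quiver V).

Lemma tensDl (w w' : bimod k Q) (e : bimod k R) :
  tens (w + w') e = tens w e + tens w' e.
Proof. by have [H _ _] := @tens_balanced k V Q R; apply: H. Qed.

Lemma tensDr (w : bimod k Q) (e e' : bimod k R) :
  tens w (e + e') = tens w e + tens w e'.
Proof. by have [_ H _] := @tens_balanced k V Q R; apply: H. Qed.

Lemma tens_ract (w : bimod k Q) f (e : bimod k R) :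
  tens (ract w f) e = tens w (lact f e).
Proof. by have [_ _ H] := @tens_balanced k V Q R; apply: H. Qed.

Lemma tens_suml (I : finType) (F : I -> bimod k Q) (e : bimod k R) :
  tens (\sum_i F i) e = \sum_i tens (F i) e.
Proof.
by apply: (morph_add_sum F (h := fun w => tens w e)) => w w'; apply: tensDl.
Qed.

Lemma tens_sumr (I : finType) (F : I -> bimod k R) (w : bimod k Q) :
  tens w (\sum_i F i) = \sum_i tens w (F i).
Proof. by apply: (morph_add_sum F) => e e'; apply: tensDr. Qed.

Lemma tens0l (e : bimod k R) : tens (0 : bimod k Q) e = 0.
Proof.
by apply: (morph_add0 (h := fun w => tens w e)) => w w'; apply: tensDl.
Qed.

Lemma tens0r (w : bimod k Q) : tens w (0 : bimod k R) = 0.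
Proof. by apply: (morph_add0 (h := tens w)) => e e'; apply: tensDr. Qed.

Lemma tensBl (w w' : bimod k Q) (e : bimod k R) :
  tens (w - w') e = tens w e - tens w' e.
Proof. by apply/(addIr (tens w' e)); rewrite -tensDl !subrK. Qed.

Lemma tensBr (w : bimod k Q) (e e' : bimod k R) :
  tens w (e - e') = tens w e - tens w e'.
Proof. by apply/(addIr (tens w e')); rewrite -tensDr !subrK. Qed.

Lemma lact_tens f (w : bimod k Q) (e : bimod k R) :
  lact f (tens w e) = tens (lact f w) e.
Proof. by apply/ffunP=> pq; rewrite !ffunE mulrA. Qed.

Lemma ract_tens f (w : bimod k Q) (e : bimod k R) :
  ract (tens w e) f = tens w (ract e f).
Proof. by apply/ffunP=> pq; rewrite !ffunE mulrA. Qed.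

Lemma lactB f (w w' : bimod k Q) : lact f (w - w') = lact f w - lact f w'.
Proof. by apply/ffunP=> p; rewrite !ffunE mulrBr. Qed.

Lemma ractB f (w w' : bimod k Q) : ract (w - w') f = ract w f - ract w' f.
Proof. by apply/ffunP=> p; rewrite !ffunE mulrBl. Qed.

Lemma additive_sub (U W : zmodType) (h : U -> W) :
  {morph h : x y / x + y} -> {morph h : x y / x - y}.
Proof. by move=> hD x y; apply/(addIr (h y)); rewrite -hD !subrK. Qed.

Lemma eq_on_generators (U : zmodType) (s s' : bimod k Q -> U)
    (I : finType) (F : I -> bimod k Q) :
  left_generating F ->
  {morph s : w w' / w + w'} -> {morph s' : w w' / w + w'} ->
  (forall f i, s (lact f (F i)) = s' (lact f (F i))) -> s =1 s'.
Proof.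
move=> genF sD s'D ss' t; rewrite (basis_sum t) !morph_add_sum //.
apply: eq_bigr => p _; have [i ->] := genF p.
rewrite (_ : _ *: _ = lact (t p *: basis k (src p)) (F i)) ?ss'//.
by apply/ffunP=> q; rewrite !(fctZ, ffunE) mulrA.
Qed.
End Bimodules.

Section Associativity.
Variables (k : fieldType) (V : finType) (Q R S : quiver V).

Lemma assocD : {morph @assoc k V Q R S : t t' / t + t'}.
Proof. exact/liftD/balanced_assoc. Qed.

Lemma unassocD : {morph @unassoc k V Q R S : t t' / t + t'}.
Proof. exact/liftD/balanced_unassoc. Qed.
End Associativity.

Section LeftGenerating.
Variables (k : fieldType) (V : finType) (Q R : quiver V).

Lemma basis_tens (pq : tensor_quiver Q R) :
  basis k pq = tens (basis k (val pq).1) (basis k (val pq).2).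
Proof.
apply/ffunP=> u; rewrite !ffunE -natrM mulnb -val_eqE /=.
by case: (val u) (val pq) => [? ?] [].
Qed.

Lemma ract_basis (p : Q) : ract (basis k p) (basis k (tgt p)) = basis k p.
Proof.
apply/ffunP=> q; rewrite !ffunE.
by have [->|_] := eqVneq q p; rewrite ?eqxx ?mulr1 ?mul0r.
Qed.

(** The coefficient at the source of the second arrow is moved through the tensor
    sign, where it acts as the identity on the first arrow of a composable
    pair. *)
Lemma left_generating_tens (I J : finType)
    (F : I -> bimod k Q) (F' : J -> bimod k R) :
  left_generating F -> left_generating F' ->
  left_generating (fun ij => tens (F ij.1) (F' ij.2)).
Proof.
move=> genF genF' pq; have [i Fi] := genF (val pq).1.
have [j F'j] := genF' (val pq).2; exists (i, j).
rewrite basis_tens F'j -tens_ract -(eqP (valP pq)) ract_basis Fi.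
by rewrite lact_tens.
Qed.
End LeftGenerating.

Section Sigma.
Variables (k : fieldType) (V : finType) (Q : quiver V).
Variable sigma : bimod k (tensor_quiver Q Q) -> bimod k (tensor_quiver Q Q).
Hypothesis sP : bimodule_map sigma.

Lemma sigma12D : {morph sigma12 sigma : t t' / t + t'}.
Proof.
have [sD _ sR] := sP; apply: liftD; split=> [e w w'|w e e'|w f e].
- by rewrite sD tensDl.
- by rewrite tensDr.
- by rewrite sR tens_ract.
Qed.

Lemma sigma23D : {morph sigma23 sigma : t t' / t + t'}.
Proof.
have [sD sL _] := sP; move=> t t'; rewrite /sigma23.
rewrite unassocD liftD ?assocD //; split=> [e w w'|w e e'|w f e].
- by rewrite tensDl.
- by rewrite sD tensDr.
- by rewrite sL tens_ract.
Qed.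

(** Both sides of the braid relation are additive, as sigma_12 and sigma_23
    are. *)
Lemma braid_on_generators (I : finType)
    (F : I -> bimod k (tensor_quiver (tensor_quiver Q Q) Q)) :
  left_generating F ->
  (forall f i,
     sigma12 sigma (sigma23 sigma (sigma12 sigma (lact f (F i)))) =
     sigma23 sigma (sigma12 sigma (sigma23 sigma (lact f (F i))))) ->
  forall t, sigma12 sigma (sigma23 sigma (sigma12 sigma t)) =
            sigma23 sigma (sigma12 sigma (sigma23 sigma t)).
Proof.
have [D12 D23] := (sigma12D, sigma23D).
move=> genF braidF; apply: (eq_on_generators genF) => [t t'|t t'|f i].
- by rewrite D12 D23 D12.
- by rewrite D23 D12 D23.
- exact: braidF.
Qed.

Lemma sigma12_sigma23_sum (I : finType) (F : I -> bimod k Q) t :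
  sigma12 sigma (sigma23 sigma (tens t (\sum_i F i))) =
  \sum_i sigma12 sigma (sigma23 sigma (tens t (F i))).
Proof.
by rewrite tens_sumr (morph_add_sum _ sigma23D) (morph_add_sum _ sigma12D).
Qed.
End Sigma.

(** * Connections on a digraph *)

Section Digraph.
Variables (k : fieldType) (V : finType) (g : rel V).
Notation O1 := (Omega1 g).

Lemma omegaE x y (p : O1) :
  omega k g x y p = ((src p == x) && (tgt p == y))%:R.
Proof. by rewrite ffunE [val p]surjective_pairing. Qed.

Lemma tens_omegaE x y z (pq : Omega2 g) :
  tens (omega k g x y) (omega k g y z) pq =
  [&& src pq == x, tgt (val pq).1 == y & tgt pq == z]%:R.
Proof.
rewrite tensE !omegaE -natrM mulnb -(eqP (valP pq)).
by rewrite -andbA [X in _ && X]andbA andbb.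
Qed.

Lemma omega0 x y : ~~ g x y -> omega k g x y = 0.
Proof.
move=> ngxy; apply/ffunP=> p; rewrite !ffunE.
by have [e|//] := eqVneq (val p) (x, y); case/negP: ngxy;
  have := valP p; rewrite e.
Qed.

Lemma sum_omega (c : V -> V -> k) (p : O1) :
  (\sum_x \sum_(y | g x y) c x y *: omega k g x y) p = c (src p) (tgt p).
Proof.
rewrite sum_ffunE (bigD1 (src p)) //= sum_ffunE (bigD1 (tgt p)) /=;
  last exact: (valP p).
rewrite fctZ omegaE !eqxx mulr1 !big1 ?addr0 // => [x nx|y ny].
  rewrite sum_ffunE big1 // => y _.
  by rewrite fctZ omegaE eq_sym (negPf nx) mulr0.
case/andP: ny => _ ny.
by rewrite fctZ omegaE [tgt p == y]eq_sym (negPf ny) andbF mulr0.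
Qed.

Lemma thetaE (p : O1) : theta k g p = 1.
Proof.
rewrite -[RHS](sum_omega (fun _ _ => 1) p) /theta.
by under [in RHS]eq_bigr do under eq_bigr do rewrite scale1r.
Qed.

Lemma diffE (f : fct k V) (p : O1) : diff g f p = f (tgt p) - f (src p).
Proof. exact: (sum_omega (fun x y => f y - f x)). Qed.

(** The calculus is inner. *)
Lemma diff_theta f : diff g f = ract (theta k g) f - lact f (theta k g).
Proof. by apply/ffunP=> p; rewrite diffE !ffunE !thetaE mul1r mulr1. Qed.

Section Connection.
Variable sigma : bimod k (Omega2 g) -> bimod k (Omega2 g).
Hypothesis sP : bimodule_map sigma.

(** The failure of w |-> theta (x) w to be left linear, and of
    w |-> sigma(w (x) theta) to be right linear, is up to sign the
    commutator of theta with f, that is, df. *)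
Lemma bimodule_connection_of : bimodule_connection sigma (connection_of sigma).
Proof.
have [sD sL sR] := sP; have sB := additive_sub sD.
split=> [w w'||f w|w f]; rewrite /connection_of //.
- by rewrite tensDl tensDr sD opprD addrACA.
- rewrite diff_theta tensBl lactB tens_ract -sL !lact_tens.
  by rewrite addrA subrK.
- rewrite diff_theta tensBr sB ractB ract_tens -sR ract_tens tens_ract.
  by rewrite addrA subrK.
Qed.

(** The two terms sigma(w (x) theta) (x) e cancel, so that whether an
    element of Omega^2 is parallel depends only on how sigma_12 sigma_23
    carries theta across it. *)
Lemma tensor_connection_ofE w e :
  tensor_connection sigma (connection_of sigma) (tens w e) =
  tens (tens (theta k g) w) e -
  sigma12 sigma (sigma23 sigma (tens (tens w e) (theta k g))).
Proof.
rewrite tensor_connection_tens; last exact: bimodule_connection_of.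
rewrite sigma23_tens // /connection_of tensBl tensBr.
rewrite (additive_sub (@assocD k V O1 O1 O1)) (additive_sub (sigma12D sP)) //.
by rewrite assoc_tens sigma12_tens // addrA subrK.
Qed.

Lemma tensor_connection_ofD :
  {morph tensor_connection sigma (connection_of sigma) : t t' / t + t'}.
Proof.
have [nD _ _ _] := bimodule_connection_of.
move=> t t'; rewrite /tensor_connection /lift -big_split.
apply: eq_bigr => pq _; rewrite ffunE scalerDl nD !tensDl assocD (sigma12D sP).
exact: addrACA.
Qed.

Lemma tensor_connection_of_eq0 (I : finType) (w e : I -> bimod k O1) :
  \sum_i sigma12 sigma (sigma23 sigma (tens (tens (w i) (e i)) (theta k g))) =
    \sum_i tens (tens (theta k g) (w i)) (e i) ->
  tensor_connection sigma (connection_of sigma) (\sum_i tens (w i) (e i)) = 0.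
Proof.
move=> transport; rewrite (morph_add_sum _ tensor_connection_ofD).
rewrite (eq_bigr _ (fun i _ => tensor_connection_ofE (w i) (e i))).
by rewrite sumrB transport subrr.
Qed.
End Connection.

(** Symmetry of the graph supplies, for each arrow x -> y, the reversed arrow with
    which it is paired. *)
Lemma eucl_pairingE (W E : V -> V -> k) (w e : bimod k O1) x :
  symmetric g ->
  (forall p, w p = W (src p) (tgt p)) -> (forall p, e p = E (src p) (tgt p)) ->
  eucl_pairing w e x = \sum_(y | g x y) W x y * E y x.
Proof.
move=> gsym wE eE.
transitivity (\sum_(xy | g xy.1 xy.2) (xy.1 == x)%:R * (W x xy.2 * E xy.2 x)).
  rewrite (reindex_omap (val : O1 -> V * V) insub) /=;
    last by move=> xy gxy; rewrite insubT.
  rewrite /eucl_pairing sum_ffunE.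
  apply: eq_big => [p|p _]; first by rewrite valK eqxx andbT (valP p).
  have gp : g (tgt p) (src p) by rewrite gsym (valP p).
  pose p' : O1 := Sub (tgt p, src p) gp.
  rewrite sum_ffunE (bigD1 p') //= !(fctZ, ffunE) /= !eqxx wE eE /= !mul1r.
  rewrite big1 ?addr0 => [|q nq].
    rewrite [x == _]eq_sym; case: eqVneq => [->|_]; last by rewrite mulr0 mul0r.
    by rewrite mulr1 mul1r.
  rewrite !(fctZ, ffunE) -natrM mulnb; case: eqP => /= [e1|_];
    last by rewrite mul0r mulr0.
  case: eqP => [e2|_]; last by rewrite mul0r mulr0.
  by case/eqP: nq; apply/val_inj; rewrite /= e1 e2; apply: surjective_pairing.
rewrite -(pair_big_dep xpredT g
  (fun x' y => (x' == x)%:R * (W x y * E y x))) /=.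
rewrite (bigD1 x) //= [X in _ + X]big1 ?addr0 => [|x' /negPf nx].
  by apply: eq_bigr => y _; rewrite eqxx mul1r.
by rewrite big1 // => y _; rewrite nx mul0r.
Qed.

(** The pairing of a 2-step detects only whether it is closed; on composable pairs
    the condition on the middle vertices is automatic. *)
Lemma eucl_invE (t : bimod k (Omega2 g)) :
  eucl_inv t = \sum_(pq : Omega2 g)
    t pq *: ((src pq == tgt pq)%:R *: basis k (src pq)).
Proof.
apply: eq_bigr => pq _; have /eqP/= pq_eq := valP pq.
rewrite /eucl_pairing (bigD1 (val pq).1) //= [X in X + _](bigD1 (val pq).2) //=.
rewrite fctZ !ffunE !eqxx {}pq_eq eqxx !mulr1.
rewrite !big1 ?addr0 // => [p' /negPf np|q' /negPf nq].
  by rewrite big1 // => q' _; rewrite fctZ ffunE np mulr0 mul0r scale0r.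
by rewrite [basis k _ q']ffunE nq mulr0 scale0r.
Qed.

Lemma eucl_invD : {morph @eucl_inv k V g : t t' / t + t'}.
Proof.
move=> t t'; rewrite !eucl_invE -big_split; apply: eq_bigr => pq _.
by rewrite ffunE scalerDl.
Qed.

Lemma eucl_invZ c (t : bimod k (Omega2 g)) : eucl_inv (c *: t) = c *: eucl_inv t.
Proof.
rewrite !eucl_invE scaler_sumr; apply: eq_bigr => pq _.
by rewrite fctZ -scalerA.
Qed.
End Digraph.

(** * Left-invariant forms on a Cayley graph *)

Section Cayley.
Variables (k : fieldType) (gT : finGroupType) (C : {set gT}).
Notation E := (cayley C).
Notation sigma := (@cayley_sigma k gT C).
Notation e := (@left_form k gT C).

Lemma left_formE a (p : Omega1 E) : e a p = (tgt p == src p * a)%g%:R.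
Proof.
rewrite sum_ffunE (bigD1 (src p)) //= omegaE eqxx.
rewrite big1 ?addr0 // => x /negPf nx.
by rewrite omegaE eq_sym nx.
Qed.

(** This makes it harmless to index left-invariant forms by the whole group. *)
Lemma left_form0 a : a \notin C -> e a = 0.
Proof.
by move=> aC; rewrite /left_form big1 // => x _; rewrite omega0 // /cayley mulKg.
Qed.

Lemma sum_left_form : \sum_a e a = theta k E.
Proof.
apply/ffunP=> p; rewrite thetaE sum_ffunE (bigD1 ((src p)^-1 * tgt p)%g) //=.
rewrite left_formE mulKVg eqxx big1 ?addr0 // => a na; rewrite left_formE.
by case: eqP => // pa; case/eqP: na; apply: (canRL (mulKg _)).
Qed.

Lemma tens_left_form a b : tens (e a) (e b) =
  \sum_x tens (omega k E x (x * a)%g) (omega k E (x * a)%g (x * a * b)%g).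
Proof.
apply/ffunP=> pq; rewrite tensE !left_formE sum_ffunE (bigD1 (src pq)) //.
rewrite tens_omegaE big1 => [|x /negPf nx]; last by rewrite tens_omegaE eq_sym nx.
rewrite [RHS]addr0 eqxx -natrM mulnb -(eqP (valP pq)).
by case: eqP => //= ->.
Qed.

Lemma eucl_metric_left_form :
  eucl_metric k E = \sum_a tens (e a) (e a^-1%g).
Proof.
under eq_bigr do rewrite tens_left_form; rewrite exchange_big.
apply: eq_bigr => x _; rewrite big_mkcond (reindex (mulg x)) /=;
  last by exists (mulg x^-1%g) => y _; rewrite ?mulKg ?mulKVg.
apply: eq_bigr => a _; rewrite mulgK; case: ifP => // /negbT nE.
by rewrite (omega0 _ nE) tens0l.
Qed.

Lemma left_generating_left_form : left_generating e.
Proof.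
move=> p; exists ((src p)^-1 * tgt p)%g; apply/ffunP=> q.
rewrite [in RHS]ffunE left_formE !ffunE -natrM mulnb.
have [->|nqp] := eqVneq q p; first by rewrite !eqxx mulKVg eqxx.
case: eqP => //= sqp; rewrite sqp mulKVg; case: eqP => // tqp.
case/eqP: nqp; apply/val_inj => /=.
by rewrite [LHS]surjective_pairing [RHS]surjective_pairing; congr (_, _).
Qed.

(** Replacing x -> y -> z by x -> x y^-1 z -> z fixes both endpoints, and the two
    actions of k(G) depend only on the endpoints. *)
Lemma cayley_sigma_bimodule_map : bimodule_map sigma.
Proof.
split=> [t t'|f t|t f].
- rewrite /cayley_sigma -big_split; apply: eq_bigr => pq _.
  by rewrite ffunE scalerDl.
- apply/ffunP=> u; rewrite [RHS]ffunE !sum_ffunE mulr_sumr.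
  apply: eq_bigr => pq _.
  rewrite !fctZ tens_omegaE ffunE.
  case: and3P => [[/eqP su _ _]|_]; last by rewrite !mulr0.
  by rewrite (su : src u = src pq) mulrA.
- apply/ffunP=> u; rewrite [RHS]ffunE !sum_ffunE mulr_suml.
  apply: eq_bigr => pq _.
  rewrite !fctZ tens_omegaE ffunE.
  case: and3P => [[_ _ /eqP tu]|_]; last by rewrite !mulr0 mul0r.
  by rewrite (tu : tgt u = tgt pq) mulrAC.
Qed.

Hypothesis C_inv : forall a, a \in C -> (a^-1)%g \in C.
Hypothesis C_conj : forall a b, a \in C -> b \in C -> (b^-1 * a * b)%g \in C.

Lemma cayley_sym : symmetric E.
Proof.
have H x y : E x y -> E y x by move=> /C_inv; rewrite invMg invgK.
by move=> x y; apply/idP/idP; apply: H.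
Qed.

(** With y = xa and z = xab the new middle vertex is xb, and the second step is
    b^-1 a b. *)
Lemma cayley_two_step x y z : E x y -> E y z ->
  E x (x * y^-1 * z)%g /\ E (x * y^-1 * z)%g z.
Proof.
rewrite /cayley => xy yz; rewrite -!mulgA mulKg; split=> //.
have := C_conj xy yz.
by rewrite !invMg !invgK !mulgA mulgK.
Qed.

(** * The conjugation braiding *)

(** For a and b in C this is the definition of sigma summed along x. Otherwise
    both sides vanish; when b is in C and a is not, this uses that b^-1 a b in C
    would force a in C, conjugating back by b^-1. *)
Lemma sigma_left_form a b :
  sigma (tens (e a) (e b)) = tens (e b) (e (b^-1 * a * b)%g).
Proof.
have [sD _ _] := cayley_sigma_bimodule_map.
have [aC|aC] := boolP (a \in C); last first.
  rewrite (left_form0 aC) tens0l (morph_add0 sD).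
  have [bC|bC] := boolP (b \in C); last by rewrite (left_form0 bC) tens0l.
  rewrite [e (_ * _)%g]left_form0 ?tens0r //; apply: contra aC => abC.
  have := C_conj abC (C_inv bC).
  by rewrite invgK !mulgA mulgV mul1g mulgK.
have [bC|bC] := boolP (b \in C); last first.
  by rewrite (left_form0 bC) tens0l tens0r (morph_add0 sD).
rewrite !tens_left_form (morph_add_sum _ sD).
apply: eq_bigr => x _; rewrite cayley_sigma_omega ?/cayley ?mulKg //.
by rewrite invMg !mulgA !mulgKV mulgK.
Qed.

(** The coefficient f stays in the leftmost factor, since sigma is left linear. *)
Lemma sigma12_left_form f a b (z : bimod k (Omega1 E)) :
  sigma12 sigma (tens (tens (lact f (e a)) (e b)) z) =
  tens (tens (lact f (e b)) (e (b^-1 * a * b)%g)) z.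
Proof.
have sP := cayley_sigma_bimodule_map; have [_ sL _] := sP.
by rewrite sigma12_tens // -lact_tens sL sigma_left_form lact_tens.
Qed.

Lemma sigma23_left_form (w : bimod k (Omega1 E)) a b :
  sigma23 sigma (tens (tens w (e a)) (e b)) =
  tens (tens w (e b)) (e (b^-1 * a * b)%g).
Proof.
have sP := cayley_sigma_bimodule_map.
by rewrite sigma23_tens // sigma_left_form assoc_tens.
Qed.

(** * Metric compatibility, braid relation and Laplacian *)

Lemma cayley_metric_compatible : metric_compatible sigma (connection_of sigma).
Proof.
have sP := cayley_sigma_bimodule_map.
rewrite /metric_compatible eucl_metric_left_form.
apply: tensor_connection_of_eq0 => //.
transitivity (\sum_b \sum_a tens (tens (e b) (e (a ^ b)%g)) (e (a ^ b)^-1%g)).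
  rewrite [RHS]exchange_big; apply: eq_bigr => a _.
  rewrite -[in LHS]sum_left_form sigma12_sigma23_sum //.
  apply: eq_bigr => b _.
  rewrite sigma23_left_form sigma12_tens // sigma_left_form.
  by rewrite -conjVg /conjg !mulgA.
transitivity (\sum_b \sum_a tens (tens (e b) (e a)) (e a^-1%g)).
  (* For fixed b, a^b is substituted for a on the right-hand side. *)
  by apply: eq_bigr => b _; rewrite [RHS](reindex_inj (conjg_inj b)).
rewrite [LHS]exchange_big; apply: eq_bigr => a _.
by rewrite -sum_left_form !tens_suml.
Qed.

Lemma connection_of_left_form a : connection_of sigma (e a) =
  \sum_(b in C) tens (e b) (e a - e (b^-1 * a * b)%g).
Proof.
have sP := cayley_sigma_bimodule_map; have [sD _ _] := sP.
rewrite /connection_of -sum_left_form tens_suml tens_sumr.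
rewrite (morph_add_sum _ sD) -sumrB.
rewrite [RHS]big_mkcond; apply: eq_bigr => b _; rewrite sigma_left_form.
case: ifP => [_|/negbT bC]; first by rewrite tensBr.
by rewrite (left_form0 bC) !tens0l subrr.
Qed.

(** On e_a (x) e_b (x) e_c both sides give e_c (x) e_{b^c} (x) e_{(a^b)^c}, the
    right-hand side with last index (a^c)^(b^c). *)
Lemma cayley_braid t :
     sigma12 sigma (sigma23 sigma (sigma12 sigma t)) =
     sigma23 sigma (sigma12 sigma (sigma23 sigma t)).
Proof.
have sP := cayley_sigma_bimodule_map.
move: t; have gen1 := left_generating_left_form.
have gen := left_generating_tens (left_generating_tens gen1 gen1) gen1.
apply: (braid_on_generators sP gen) => f [[a b] c].
rewrite ![(_, _).1]/= ![(_, _).2]/= 2!lact_tens.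
rewrite sigma12_left_form 2!sigma23_left_form.
rewrite 2!sigma12_left_form sigma23_left_form.
by rewrite !invMg !invgK !mulgA !mulgK.
Qed.

(** The inverse metric of a 2-step depends only on its endpoints, which sigma
    preserves. *)
Lemma eucl_inv_sigma t : eucl_inv (sigma t) = eucl_inv t.
Proof.
rewrite /cayley_sigma (morph_add_sum _ (@eucl_invD _ _ _)) eucl_invE.
apply: eq_bigr => pq _; rewrite eucl_invZ eucl_inv_tens; congr (_ *: _).
set p := (val pq).1; set q := (val pq).2.
have pE : E (src p) (tgt p) := valP p.
have qE : E (tgt p) (tgt q)
  by rewrite (eqP (valP pq) : tgt p = src q); apply: (valP q).
have [xu uz] := cayley_two_step pE qE.
by rewrite eucl_pairing_omega // eqxx mulr1.
Qed.

Lemma cayley_laplace_beltrami f :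
  laplace_beltrami (connection_of sigma) f = 2%:R *: laplacian E f.
Proof.
rewrite /laplace_beltrami /connection_of (additive_sub (@eucl_invD _ _ _)).
rewrite eucl_inv_sigma !eucl_inv_tens; apply/ffunP=> x; rewrite !ffunE.
pose grad y z : k := f z - f y; pose one (_ _ : gT) : k := 1.
rewrite (eucl_pairingE (W := one) (E := grad)) //; last 3 first.
- exact: cayley_sym.
- exact: thetaE.
- exact: diffE.
rewrite (eucl_pairingE (W := grad) (E := one)) //; last 3 first.
- exact: cayley_sym.
- exact: diffE.
- exact: thetaE.
rewrite scaler_sumr -sumrB; apply: eq_bigr => y _.
by rewrite scaler_nat /grad /one mul1r mulr1 opprB mulr2n.
Qed.

End Cayley.

Theorem proposition3p10 (k : fieldType) (gT : finGroupType) (C : {set gT})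
    (char_k : 2%N \notin [pchar k])
    (C1 : (1%g : gT) \notin C)
    (C_gen : <<C>>%g = [set: gT])
    (C_inv : forall a, a \in C -> (a^-1)%g \in C)
    (C_conj : forall a b, a \in C -> b \in C -> (b^-1 * a * b)%g \in C) :
  let E := cayley C in
  let sigma := @cayley_sigma k gT C in
  let nabla := connection_of sigma in
  let e := @left_form k gT C in
  (forall x y z : gT, E x y -> E y z ->
     E x (x * y^-1 * z)%g /\ E (x * y^-1 * z)%g z) /\
  bimodule_connection sigma nabla /\
  metric_compatible sigma nabla /\
  (forall a, a \in C ->
     nabla (e a) = \sum_(b in C) tens (e b) (e a - e (b^-1 * a * b)%g)) /\
  (forall a b, a \in C -> b \in C ->
     sigma (tens (e a) (e b)) = tens (e b) (e (b^-1 * a * b)%g)) /\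
  (forall t : bimod k (Omega3 E),
     sigma12 sigma (sigma23 sigma (sigma12 sigma t)) =
     sigma23 sigma (sigma12 sigma (sigma23 sigma t))) /\
  (forall f : fct k gT, laplace_beltrami nabla f = 2%:R *: laplacian E f).
Proof.
split; first by move=> x y z; apply: cayley_two_step.
split; first exact/bimodule_connection_of/cayley_sigma_bimodule_map.
split; first exact: cayley_metric_compatible.
split; first by move=> a _; apply: connection_of_left_form.
split; first by move=> a b _ _; apply: sigma_left_form.
split; first by move=> t; apply: cayley_braid.
by move=> f; apply: cayley_laplace_beltrami.
Qed.
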